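(* Let $D$ be a two-dimensional regular local ring with fixed regular system of parameters $x,y$, let $0<a<b$ be real numbers, and let $I=[a,b]$. Then the complete integral closure ${T_I}^*$ of the interval ring $T_I$ is a Prüfer domain.
   Context: $D$ is a two-dimensional regular local ring with maximal ideal $\mathfrak m=(x,y)$ and quotient field $K$. Every nonzero element of $D$ can be written as $u_1\tau_1+\cdots+u_n\tau_n$ with $u_i$ units of $D$ and $\tau_i$ distinct monomials $x^py^q$ ($p,q\ge 0$ integers), none of which divides another in $D$; the set of monomials $\tau_i$ is uniquely determined by the element (and $x,y$). For real $r>0$, the monomial valuation $v_r$ on $K$ is defined by $v_r(0)=\infty$, $v_r(x^py^q)=p+qr$, $v_r(u_1\tau_1+\cdots+u_n\tau_n)=\min_i v_r(\tau_i)$ for such a representation, and $v_r(f/g)=v_r(f)-v_r(g)$ for $f,g\in D$, $g\neq 0$. Its valuation ring is $V_r=\{f\in K: v_r(f)\ge 0\}$. For $I=[a,b]$ the interval ring $T_I$ is the intersection of all valuation rings $V$ such that $D\subseteq V\subseteq V_r$ for some $r\in I$. An element $z\in K$ is almost integral over $T_I$ if there is a nonzero $c\in T_I$ with $cz^n\in T_I$ for all $n\ge 1$; the complete integral closure ${T_I}^*$ is the ring of all elements of $K$ almost integral over $T_I$. A domain is Prüfer if its localization at each prime ideal is a valuation ring. *)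

(* Defs.v *)
From HB Require Import structures.
From mathcomp Require Import all_boot all_order all_algebra.
From mathcomp Require Import boolp classical_sets set_interval reals constructive_ereal.

Set Implicit Arguments.
Unset Strict Implicit.
Unset Printing Implicit Defensive.

Import Order.TTheory GRing.Theory Num.Theory.
Local Open Scope classical_set_scope.
Local Open Scope ring_scope.

Section RegularLocal.
Variable D : comNzRingType.

Definition ideal_gen (s : seq D) : set D :=
  [set z | exists c : nat -> D, z = \sum_(i < size s) c i * s`_i].

(* [idealr_closed] includes properness; the omitted unit ideal is generated
   by 1. *)
Definition noetherian :=
  forall J : set D, idealr_closed [in J] -> exists s : seq D, J = ideal_gen s.

Definition maximal_ideal (M : set D) :=
  idealr_closed [in M] /\
  forall J : set D, idealr_closed [in J] -> M `<=` J -> J = M.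

Definition local_with (m : set D) :=
  maximal_ideal m /\ forall M, maximal_ideal M -> M = m.

Definition prime_ideal (P : set D) :=
  idealr_closed [in P] /\ prime_idealr_closed [in P].

(* P 0, ..., P n is a strictly increasing chain of prime ideals, of length n. *)
Definition prime_chain (n : nat) (P : nat -> set D) :=
  (forall i, (i <= n)%N -> prime_ideal (P i)) /\
  (forall i, (i < n)%N -> P i `<` P i.+1).

Definition krull_dim (n : nat) :=
  (exists P, prime_chain n P) /\
  (forall k P, prime_chain k P -> (k <= n)%N).

(* D is a regular local ring with regular system of parameters s: the number
   of generators of the maximal ideal listed in s is the dimension of D. *)
Definition regular_local_with (s : seq D) :=
  [/\ noetherian, local_with (ideal_gen s) & krull_dim (size s)].

End RegularLocal.

(* Subrings of a field K are subsets of K, so the notions below are relative to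
   the subset A. *)
Section Subrings.
Variable K : fieldType.
Implicit Types A P V : set K.

Definition quotient_field A : set K :=
  [set z | exists a b, [/\ A a, A b, b != 0 & z = a / b]].

Definition valuation_ring V :=
  subring_closed [in V] /\ forall z, quotient_field V z -> V z \/ V z^-1.

Definition prime_ideal_of A P :=
  [/\ P `<=` A,
      P 0 /\ ~ P 1,
      (forall a u v, A a -> P u -> P v -> P (a * u + v)) &
      forall u v, A u -> A v -> P (u * v) -> P u \/ P v].

Definition localization A P : set K :=
  [set z | exists a s, [/\ A a, A s, ~ P s & z = a / s]].

Definition prufer_domain A :=
  subring_closed [in A] /\
  forall P, prime_ideal_of A P -> valuation_ring (localization A P).

Definition almost_integral A (z : K) :=
  exists c, [/\ A c, c != 0 & forall n, (1 <= n)%N -> A (c * z ^+ n)].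

Definition complete_integral_closure A : set K := [set z | almost_integral A z].

End Subrings.

Section IntervalRing.
Variables (R : realType) (D : idomainType) (x y : D).
Local Notation K := {fraction D}.

Definition monomial (e : nat * nat) : D := x ^+ e.1 * y ^+ e.2.

Definition divides (d z : D) := exists c, z = c * d.

(* s lists the pairs (u_i, exponents of tau_i) of a representation
   f = u_1 tau_1 + ... + u_n tau_n. *)
Definition monomial_rep (f : D) (s : seq (D * (nat * nat))) :=
  [/\ f = \sum_(t <- s) t.1 * monomial t.2,
      {in s, forall t, t.1 \is a GRing.unit},
      uniq [seq monomial t.2 | t <- s] &
      {in s &, forall t t', monomial t.2 != monomial t'.2 ->
                            ~ divides (monomial t.2) (monomial t'.2)}].

(* When D is regular local with parameters x, y, every nonzero f has such a
   representation, and its monomials do not depend on the one chosen; the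
   default values of [xget] are then never used, here and in [monomial_val]. *)
Definition monomial_val_ring (r : R) (f : D) : \bar R :=
  if f == 0 then +oo%E else
  \big[Order.min/+oo%E]_(t <- xget [::] [set s | monomial_rep f s])
     (t.2.1%:R + t.2.2%:R * r)%:E.

Definition monomial_val (r : R) (z : K) : \bar R :=
  xget +oo%E [set w | exists f g : D,
    [/\ g != 0, z = tofrac f / tofrac g &
        w = (monomial_val_ring r f - monomial_val_ring r g)%E]].

Definition monomial_val_valuation_ring (r : R) : set K :=
  [set z | (0 <= monomial_val r z)%E].

Definition interval_ring (I : set R) : set K :=
  \bigcap_(V in [set V : set K | [/\ valuation_ring V, range (@tofrac D) `<=` V
      & exists2 r, I r & V `<=` monomial_val_valuation_ring r]]) V.

End IntervalRing.

(* Main.v *)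
Require Import Defs.
From HB Require Import structures.
From mathcomp Require Import all_boot all_order all_algebra.
From mathcomp Require Import boolp classical_sets set_interval reals constructive_ereal.
From mathcomp Require Import ring lra zify.

Set Implicit Arguments.
Unset Strict Implicit.
Unset Printing Implicit Defensive.

Import Order.TTheory GRing.Theory Num.Theory.
Local Open Scope classical_set_scope.
Local Open Scope ring_scope.

(** Let [A] be the intersection of the rings of the monomial valuations [v_r],
[r] in [I].  The complete integral closure of the interval ring [T] is [A]
(complete_integral_closure_interval_ring).  On one side, [T] is contained in
every [V_r], and [c z^n] in [V_r] for all [n] forces [v_r(z) >= 0].  On the
other side, if [v_r(z) >= 0] for all [r] in [I] then [x z^n] has positive value
for every [v_r], so it lies in the maximal ideal of [V_r], hence in every
valuation ring between [D] and [V_r].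

[A] is Pruefer because monomials control everything
(monomial_intersection_prufer).  If [m] and [m'] are distinct monomials, no
cancellation occurs in [m + m'], so [m / (m + m')] and [m' / (m + m')] belong to
[A]; their sum is 1, so a prime [P] of [A] misses one of them, and one of
[m / m'], [m' / m] is in [A_P].  Monomials are thus totally preordered by
divisibility in [A_P].  A nonzero [f = u_1 t_1 + ... + u_n t_n] of [D] is then a
unit of [A_P] times the monomial [t_i] dividing all the others: [f / t_i] is in
[A_P], and [t_i / f] is in [A] since [v_r(f) <= v_r(t_i)] for all [r].  Hence for
nonzero [f], [g] in [D], one of [f / g], [g / f] is in [A_P].

It remains to see that the representations of elements of [D] exist and that
[v_r] is a valuation.  The key facts are that no power of [y] is a multiple of
[x] (y_power_notin, the principal ideal theorem in the case at hand) and Krull's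
intersection theorem (krull_intersection).  They show that [x] is prime and
that [x^p y^q] is not in the ideal [(x^(p+1), y^(q+1))] (monomial_notin).
Order the exponents [(p, q)] lexicographically by [p + q r] and then [p]: by
the last fact, every nonzero element has a well-defined leading exponent, leading
exponents add up in products, and [v_r] is the weight [p + q r] of the leading
exponent. *)

(** * Ideals of a Noetherian domain *)

Section Ideals.
Variable D : idomainType.
Implicit Types (J Q N B P : set D).

(** Unlike [idealr_closed], this allows the unit ideal, so that sums and unions
of ideals need no properness proof. *)
Definition is_ideal J := J 0 /\ forall a u v, J u -> J v -> J (a * u + v).

Lemma is_idealM J a u : is_ideal J -> J u -> J (a * u).
Proof. by move=> [J0 JD] Ju; rewrite -[a * u]addr0; apply: JD. Qed.

Lemma is_idealD J u v : is_ideal J -> J u -> J v -> J (u + v).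
Proof. by move=> [J0 JD] Ju Jv; rewrite -[u]mul1r; apply: JD. Qed.

Lemma is_idealB J u v : is_ideal J -> J u -> J v -> J (u - v).
Proof. by move=> JI Ju Jv; rewrite -[- v]mulN1r addrC; apply: JI.2. Qed.

Lemma is_ideal_sum J (T : eqType) (s : seq T) (F : T -> D) :
  is_ideal J -> (forall i, i \in s -> J (F i)) -> J (\sum_(i <- s) F i).
Proof.
move=> JI JF; rewrite big_seq; elim/big_rec: _ => [|i v si Jv]; first exact: JI.1.
by apply: is_idealD => //; apply: JF.
Qed.

Lemma idealr_closedP J :
  idealr_closed [in J] <-> is_ideal J /\ ~ J 1.
Proof.
split=> [[J0 J1 JD]|[[J0 JD] J1]].
  split; first split.
  - by move: J0; rewrite inE.
  - move=> a u v Ju Jv; have := JD a u v; rewrite !inE; exact.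
  - by move: J1; rewrite notin_setE.
split; [by rewrite inE|by rewrite notin_setE|].
by move=> a u v; rewrite !inE; apply: JD.
Qed.

Lemma ideal_gen_ideal (s : seq D) : is_ideal (ideal_gen s).
Proof.
split; first by exists (fun=> 0); rewrite big1 // => i _; rewrite mul0r.
move=> a u v [c ->] [d ->]; exists (fun i => a * c i + d i).
rewrite mulr_sumr -big_split; apply: eq_bigr => i _ /=.
by rewrite mulrDl mulrA.
Qed.

Lemma ideal_gen_cons g (s : seq D) z :
  ideal_gen (g :: s) z <-> exists c, ideal_gen s (z - c * g).
Proof.
split=> [[c ->]|[c [d e]]].
  exists (c 0%N); exists (fun i => c i.+1).
  by rewrite big_ord_recl /= addrC addKr.
exists (fun i => if i is j.+1 then d j else c); rewrite big_ord_recl /= -e.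
by rewrite addrC subrK.
Qed.

Lemma ideal_gen_mem (s : seq D) g : g \in s -> ideal_gen s g.
Proof.
elim: s => // h s IH; rewrite inE => /orP[/eqP ->|gs]; apply/ideal_gen_cons.
  by exists 1; rewrite mul1r subrr; apply: (ideal_gen_ideal s).1.
by exists 0; rewrite mul0r subr0; apply: IH.
Qed.

Lemma ideal_gen_sub (s : seq D) J : is_ideal J ->
  (forall g, g \in s -> J g) -> ideal_gen s `<=` J.
Proof.
move=> JI; elim: s => [|h s IH] sJ z.
  by case=> c; rewrite big_ord0 => ->; apply: JI.1.
move/ideal_gen_cons=> [c /IH zc]; rewrite -[z](subrK (c * h)).
apply: is_idealD => //.
  by apply: zc => g gs; apply: sJ; rewrite inE gs orbT.
by apply: is_idealM => //; apply: sJ; rewrite inE eqxx.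
Qed.

Lemma noetherian_fg J : noetherian D -> is_ideal J ->
  exists s, J = ideal_gen s.
Proof.
move=> nD JI; have [J1|J1] := pselect (J 1); last first.
  by apply: nD; apply/idealr_closedP.
exists [:: 1]; apply/seteqP; split=> z _.
  rewrite -[z]mulr1; apply: is_idealM; first exact: ideal_gen_ideal.
  by apply: ideal_gen_mem; rewrite inE.
by rewrite -[z]mulr1; apply: is_idealM.
Qed.

Lemma noetherian_acc (J : nat -> set D) : noetherian D ->
  (forall i, is_ideal (J i)) -> (forall i, J i `<=` J i.+1) ->
  exists n, forall i, J i `<=` J n.
Proof.
move=> nD JI Jinc.
have Jle i j : (i <= j)%N -> J i `<=` J j.
  move=> /subnKC <-; elim: (j - i)%N => [|k IH]; first by rewrite addn0.
  by rewrite addnS; apply: subset_trans IH (Jinc _).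
have UI : is_ideal [set z | exists i, J i z].
  split; first by exists 0%N; apply: (JI 0%N).1.
  move=> a u v [i Ji] [j Jj]; exists (maxn i j); apply: (JI _).2.
    exact: Jle (leq_maxl _ _) _ Ji.
  exact: Jle (leq_maxr _ _) _ Jj.
have [s Us] := noetherian_fg nD UI.
have [n sn] : exists n, forall g, g \in s -> J n g.
  have : forall g, g \in s -> exists i, J i g.
    by move=> g /ideal_gen_mem; rewrite -Us.
  elim: (s) => [|h t IH] ht; first by exists 0%N.
  have [n tn] : exists n, forall g, g \in t -> J n g.
    by apply: IH => g gt; apply: ht; rewrite inE gt orbT.
  have [i Ji] : exists i, J i h by apply: ht; rewrite inE eqxx.
  exists (maxn i n) => g; rewrite inE => /orP[/eqP ->|/tn].
    exact: Jle (leq_maxl _ _) _ Ji.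
  exact: Jle (leq_maxr _ _) _.
exists n => i z Jz; apply: (ideal_gen_sub (JI n) sn).
by rewrite -Us; exists i.
Qed.

(** Generators of [Q] are discarded one at a time: modulo [N] and the others, a
generator [g] satisfies [g = c t g], and [1 - c t] is a unit. *)
Lemma nakayama Q N (t : D) : noetherian D -> is_ideal Q -> is_ideal N ->
  (forall c, 1 - c * t \is a GRing.unit) ->
  (forall q, Q q -> exists n q', [/\ N n, Q q' & q = n + t * q']) -> Q `<=` N.
Proof.
move=> nD QI NI tu QN; have [s Qs] := noetherian_fg nD QI.
have : forall q, Q q -> exists2 n, N n & ideal_gen s (q - n).
  by move=> q Qq; exists 0; [exact: NI.1|rewrite subr0 -Qs].
have : forall g, g \in s -> Q g by move=> g /ideal_gen_mem; rewrite -Qs.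
elim: s {Qs} => [|g s IH] sQ Qsub.
  by move=> q /Qsub [n Nn [c]]; rewrite big_ord0 => /subr0_eq ->.
apply: IH => [h hs|q Qq]; first by apply: sQ; rewrite inE hs orbT.
have sI := ideal_gen_ideal s.
have [n Nn ng] : exists2 n, N n & ideal_gen s (g - n).
  have [|n [q' [Nn Qq' e]]] := QN g; first by apply: sQ; rewrite inE eqxx.
  have [m Nm /ideal_gen_cons[c scg]] := Qsub _ Qq'.
  pose v := (1 - c * t)^-1.
  have eg : g = v * (n + t * m) + v * t * (q' - m - c * g).
    by apply: (mulrI (tu c)); rewrite mulrDr !mulrA mulrV // [LHS]mulrBl mul1r {1}e; ring.
  exists (v * (n + t * m)).
    by apply: is_idealM => //; apply: is_idealD => //; apply: is_idealM.
  by rewrite {1}eg addrC addKr; apply: is_idealM.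
have [m Nm /ideal_gen_cons[c scg]] := Qsub _ Qq.
exists (m + c * n); first by apply: is_idealD => //; apply: is_idealM.
have -> : q - (m + c * n) = (q - m - c * g) + c * (g - n) by ring.
by apply: is_idealD => //; apply: is_idealM.
Qed.

End Ideals.

(** * Regular parameters *)

Section RegularParameters.
Variable D : idomainType.
Implicit Types (x y : D) (J Q N B P : set D).

(** The middle term of a chain of primes of length two: a nonzero prime ideal
that misses some nonunit. *)
Definition prime_not_maximal P := [/\ is_ideal P, ~ P 1,
  (forall u v, P (u * v) -> P u \/ P v), exists2 a, P a & a != 0 &
  exists2 b, ~ P b & b \isn't a GRing.unit].

(** The consequences of regularity used below, in a form symmetric in [x] and
[y]. *)
Definition regular_parameters x y := [/\ noetherian D,
  (forall a, a \isn't a GRing.unit <-> exists c d, a = c * x + d * y) &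
  exists P, prime_not_maximal P].

Lemma regular_parametersC x y : regular_parameters x y -> regular_parameters y x.
Proof.
move=> [nD ux hP]; split=> // a; rewrite ux.
by split=> -[c [d ->]]; exists d, c; rewrite addrC.
Qed.

(** Zorn's lemma; the empty set is admitted among the candidates because it is
the union of the empty chain. *)
Lemma proper_ideal_maximal J : is_ideal J -> ~ J 1 ->
  exists2 M, maximal_ideal M & J `<=` M.
Proof.
move=> JI J1.
pose good := [set X : set D | X = set0 \/ [/\ is_ideal X, ~ X 1 & J `<=` X]].
have [F FP Ft|M [MP Mmax]] := @Zorn_bigcup _ good.
  have [[Y FY [y0 Yy0]]|F0] := pselect (exists2 X, F X & X !=set0); last first.
    left; apply/seteqP; split=> // z [X FX Xz].
    by apply: F0; exists X => //; exists z.
  have gY X z : F X -> X z -> [/\ is_ideal X, ~ X 1 & J `<=` X].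
    by move=> FX Xz; case: (FP _ FX) => // X0; rewrite X0 in Xz.
  right; split.
  - split; first by exists Y => //; have [YI _ _] := gY _ _ FY Yy0; exact: YI.1.
    move=> a u v [X FX Xu] [X' FX' Xv].
    have [XI _ _] := gY _ _ FX Xu; have [XI' _ _] := gY _ _ FX' Xv.
    have [XX|XX] := Ft _ _ FX FX'.
      by exists X' => //; apply: XI'.2 => //; apply: XX.
    by exists X => //; apply: XI.2 => //; apply: XX.
  - by move=> [X FX X1]; have [] := gY _ _ FX X1.
  - by move=> z Jz; exists Y => //; have [_ _] := gY _ _ FY Yy0; apply.
have gJ : good J by right; split.
case: MP => [M0|[MI M1 JM]].
  exfalso; apply: (Mmax J) => //; rewrite M0; split=> // H.
  by have := H 0 JI.1.
exists M => //; split; first exact/idealr_closedP.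
move=> N /idealr_closedP[NI N1] MN; apply: contrapT => nNM.
apply: (Mmax N); last by right; split=> //; apply: subset_trans MN.
by split=> // NM; apply: nNM; apply/seteqP.
Qed.

Lemma regular_local_parameters x y :
  regular_local_with [:: x; y] -> regular_parameters x y.
Proof.
move=> [nD [[mI mmax] muniq] [[P [Pp Plt]] _]].
have genE z : ideal_gen [:: x; y] z <-> exists c d, z = c * x + d * y.
  split=> [[c ->]|[c [d ->]]].
    by exists (c 0%N), (c 1%N); rewrite 2!big_ord_recl big_ord0 addr0.
  have gI := ideal_gen_ideal [:: x; y].
  apply: is_idealD => //; apply: is_idealM => //; apply: ideal_gen_mem.
    by rewrite !inE eqxx.
  by rewrite !inE eqxx orbT.
have [gI g1] := (idealr_closedP _).1 mI.
have nu J z : is_ideal J -> ~ J 1 -> J z -> z \isn't a GRing.unit.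
  move=> JI J1 Jz; apply/negP => zu; apply: J1.
  by rewrite -(mulVr zu); apply: is_idealM.
split=> //.
  move=> a; rewrite -genE; split=> [au|]; last exact: nu.
  pose J := [set z | exists c, z = c * a].
  have JI : is_ideal J.
    split; first by exists 0; rewrite mul0r.
    by move=> b u v [c ->] [d ->]; exists (b * c + d); rewrite mulrDl mulrA.
  have [|M Mm JM] := proper_ideal_maximal JI.
    move=> [c e]; case/negP: au; apply/unitrPr; exists c.
    by rewrite mulrC -e.
  by rewrite -(muniq _ Mm); apply: JM; exists 1; rewrite mul1r.
have [/idealr_closedP[P1I P11] P1p] := Pp 1%N isT.
have [/idealr_closedP[P2I P21] _] := Pp 2%N isT.
have [/idealr_closedP[P0I _] _] := Pp 0%N isT.
have [P01 nP01] := Plt 0%N isT; have [P12 nP12] := Plt 1%N isT.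
exists (P 1%N); split=> //.
- by move=> u v; have := P1p u v; rewrite !inE => H /H /orP[]; rewrite inE; [left|right].
- apply: contrapT => H; apply: nP01 => z Pz.
  have [->|z0] := eqVneq z 0; first exact: P0I.1.
  by exfalso; apply: H; exists z.
- apply: contrapT => H; apply: nP12 => z Pz.
  apply: contrapT => nPz; apply: H; exists z => //; exact: nu Pz.
Qed.

Lemma unit1B x y c d : regular_parameters x y -> 1 - (c * x + d * y) \is a GRing.unit.
Proof.
move=> [_ ux _]; apply: contrapT => /negP /ux [c' [d' e]].
suff /ux : exists c d, 1 = c * x + d * y by rewrite unitr1.
exists (c' + c), (d' + d); rewrite -(subrK (c * x + d * y) 1) e; ring.
Qed.

Section Params.
Variables x y : D.
Hypothesis reg : regular_parameters x y.

Lemma unit1Bx c : 1 - c * x \is a GRing.unit.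
Proof. by have := unit1B c 0 reg; rewrite mul0r addr0. Qed.

Lemma unit1By c : 1 - c * y \is a GRing.unit.
Proof. by have := unit1B 0 c reg; rewrite mul0r add0r. Qed.

Lemma mulD_ideal B (t : D) : is_ideal B ->
  is_ideal [set z | exists e c, B c /\ z = t * e + c].
Proof.
move=> BI; split.
  by exists 0, 0; split; [exact: BI.1|rewrite mulr0 addr0].
move=> a u v [e [c [Bc ->]]] [e' [c' [Bc' ->]]].
exists (a * e + e'), (a * c + c'); split; first exact: BI.2.
by ring.
Qed.

(** For the intersection [Q] of the ideals [t^n D + B], Nakayama's lemma reduces
the claim to [Q = t Q + B].  The annihilators of the powers of [t] modulo [B] are
stationary from some [N] on; if [q = t^(N+1) e] modulo [B], comparison with an
expression of [q] as a multiple of [t^(N+1+n)] shows that [t^N e] is a multiple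
of [t^(N+n)] modulo [B], so [t^N e] is again in [Q]. *)
Lemma krull_intersection B (t d : D) : is_ideal B ->
  (forall c, 1 - c * t \is a GRing.unit) ->
  (forall n, exists e c, B c /\ d = t ^+ n * e + c) -> B d.
Proof.
move=> BI tu; have [nD _ _] := reg.
pose K i := [set z | B (t ^+ i * z)].
pose Q := [set d | forall n, exists e c, B c /\ d = t ^+ n * e + c].
have KI i : is_ideal (K i).
  split; first by rewrite /K /= mulr0; exact: BI.1.
  move=> a u v; rewrite /K /= => Ku Kv.
  have -> : t ^+ i * (a * u + v) = a * (t ^+ i * u) + t ^+ i * v by ring.
  exact: BI.2.
have [|N KN] := noetherian_acc nD KI.
  by move=> i z; rewrite /K /= => Kz; rewrite exprS -mulrA; apply: is_idealM.
have QI : is_ideal Q.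
  split=> [n|a u v Qu Qv n]; first by have := mulD_ideal (t ^+ n) BI => -[].
  by have := mulD_ideal (t ^+ n) BI => -[_]; apply; [exact: Qu|exact: Qv].
suff QB : Q `<=` B by exact: QB.
apply: (nakayama (t := t)) => // q Qq.
have [e [c [Bc qe]]] := Qq N.+1.
exists c, (t ^+ N * e); split=> //; last by rewrite qe exprS; ring.
move=> n; have [e' [c' [Bc' qe']]] := Qq (N.+1 + n)%N.
have : K N.+1 (e - t ^+ n * e').
  rewrite /K /=.
  have -> : t ^+ N.+1 * (e - t ^+ n * e') = c' - c.
    have := qe; rewrite qe' exprD => h.
    have -> : c' = t ^+ N.+1 * e + c - t ^+ N.+1 * t ^+ n * e' by rewrite -h; ring.
    ring.
  exact: is_idealB.
move=> /KN; rewrite /K /= => h.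
exists (t ^+ N * e'), (t ^+ N * (e - t ^+ n * e')); split=> //; ring.
Qed.

Definition mult_of (t : D) : set D := [set z | exists c, z = t * c].

Lemma mult_of_ideal t : is_ideal (mult_of t).
Proof.
split; first by exists 0; rewrite mulr0.
by move=> a u v [c ->] [d ->]; exists (a * c + d); ring.
Qed.

(** Modulo [x] the maximal ideal is generated by [y], so an element is a unit
times a power of [y], or divisible by all of them and then zero by Krull's
theorem. *)
Lemma y_power_form_or d : (exists n u c, u \is a GRing.unit /\ d = y ^+ n * u + x * c)
  \/ mult_of x d.
Proof.
have [_ ux _] := reg.
have [h|h] := pselect (forall n, exists e c, mult_of x c /\ d = y ^+ n * e + c).
  by right; apply: krull_intersection h; [exact: mult_of_ideal|exact: unit1By].
left; apply: contrapT => nh; apply: h; elim=> [|n [e [c [[c' ->] de]]]].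
  by exists d, 0; split; [exact: (mult_of_ideal x).1|rewrite expr0 mul1r addr0].
have /ux [a [b eab]] : e \isn't a GRing.unit.
  by apply/negP => eu; apply: nh; exists n, e, c'.
exists b, (x * (y ^+ n * a + c')); split; first by exists (y ^+ n * a + c').
by rewrite de eab exprS; ring.
Qed.

(** The principal ideal theorem for [x].  Suppose that [y^n] is in [xD].  Then
[D / x] has finitely many ideals, each generated by a power of [y].  Let [P] be
a prime that is neither zero nor maximal, [a] a nonzero element of [P], and [Q k]
the contraction to [D] of [a^k D_P].  For some [k] the images of [Q k] and
[Q k.+1] in [D / x] agree.  As [x] is not in [P], [x d] in [Q k] implies [d] in
[Q k], so [Q k = Q k.+1 + x Q k], and [Q k = Q k.+1] by Nakayama's lemma.  Then
[a^k] is in [a^(k+1) D_P] and [a] is a unit of [D_P], a contradiction. *)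
Lemma y_power_notin n : ~ mult_of x (y ^+ n).
Proof.
move=> yn; have [nD ux [P [PI P1 Pp [a Pa a0] [b Pb bu]]]] := reg.
have nPx : ~ P x.
  move=> Px; have Py : P y.
    have : P (y ^+ n) by have [c ->] := yn; rewrite mulrC; apply: is_idealM.
    elim: n {yn} => [|n IH]; first by rewrite expr0.
    by rewrite exprS => /Pp [].
  apply: Pb; have [c [d ->]] := (ux b).1 bu.
  by apply: is_idealD => //; apply: is_idealM.
pose Q k := [set d | exists s c, ~ P s /\ s * d = a ^+ k * c].
have QI k : is_ideal (Q k).
  split; first by exists 1, 0; split=> //; ring.
  move=> f u v [s [c [Ps e]]] [s' [c' [Ps' e']]].
  exists (s * s'), (f * s' * c + s * c'); split; first by move=> /Pp[].
  have -> : s * s' * (f * u + v) = f * s' * (s * u) + s * (s' * v) by ring.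
  by rewrite e e'; ring.
pose Qx k i := exists q c, Q k q /\ y ^+ i = x * c + q.
have [k Qk] : exists k, forall i, Qx k i -> Qx k.+1 i.
  apply: contrapT => H.
  have H' k : exists2 i, Qx k i & ~ Qx k.+1 i.
    apply: contrapT => H'; apply: H; exists k => i Qi.
    by apply: contrapT => nQi; apply: H'; exists i.
  (* Otherwise the least exponent of a power of [y] in [Q k + xD] would grow
     with [k], but it never exceeds [n]. *)
  have HQ k : forall i, (i < k)%N -> ~ Qx k i.
    elim: k => // k IH i ik; have [j Qj nQj] := H' k.
    have kj : (k <= j)%N by rewrite leqNgt; apply/negP => /IH /(_ Qj).
    move=> [q [c [Qq e]]]; apply: nQj; exists (y ^+ (j - i) * q), (y ^+ (j - i) * c).
    split; first exact: is_idealM.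
    have ij : (i <= j)%N by apply: leq_trans kj.
    by rewrite -{1}(subnK ij) exprD e; ring.
  apply: (HQ n.+1 n (ltnSn n)); exists 0.
  by have [c ->] := yn; exists c; split; [exact: (QI _).1|rewrite addr0].
have : Q k `<=` Q k.+1.
  apply: (nakayama (t := x)) => //; first exact: unit1Bx.
  move=> d Qd.
  (* Up to a unit and modulo [x], [d] is zero or a power of [y]. *)
  have [q [c [Qq e]]] : exists q c, Q k.+1 q /\ d = x * c + q.
    have [[i [u [c [uu e]]]]|[c ->]] := y_power_form_or d; last first.
      by exists 0, c; split; [exact: (QI _).1|rewrite addr0].
    have [|q [c' [Qq e']]] := Qk i.
      exists (u^-1 * d), (- u^-1 * c); split; first exact: is_idealM.
      by rewrite -[LHS]mul1r -(mulVr uu) e; ring.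
    exists (u * q), (u * c' + c); split; first exact: is_idealM.
    by rewrite e e'; ring.
  exists q, c; split=> //; last by rewrite e addrC.
  have [s [f [Ps es]]] := Qd; have [s' [f' [Ps' es']]] := Qq.
  exists (s * s' * x), (s' * f - s * a * f'); split.
    by move=> /Pp[/Pp[]|].
  have -> : s * s' * x * c = s' * (s * d) - s * (s' * q) by rewrite e; ring.
  by rewrite es es' exprS; ring.
move=> /(_ (a ^+ k)) [|s [c [Ps e]]].
  by exists 1, 1; split=> //; ring.
apply: Ps; have -> : s = c * a.
  apply: (mulIf (expf_neq0 k a0)); rewrite e exprS; ring.
exact: is_idealM.
Qed.

Lemma y_power_form d : ~ mult_of x d ->
  exists n u c, u \is a GRing.unit /\ d = y ^+ n * u + x * c.
Proof. by have [] := y_power_form_or d. Qed.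

Lemma mult_of_x_prime u v : mult_of x (u * v) -> mult_of x u \/ mult_of x v.
Proof.
move=> uv; apply: contrapT => H.
have [|n [a [c [au eu]]]] := @y_power_form u; first by move=> h; apply: H; left.
have [|m [b [d [bu ev]]]] := @y_power_form v; first by move=> h; apply: H; right.
apply: (@y_power_notin (n + m)); have [e h] := uv.
exists ((a * b)^-1 * (e - y ^+ n * a * d - c * y ^+ m * b - c * x * d)).
have abu : a * b \is a GRing.unit by rewrite unitrM au.
have E : a * b * y ^+ (n + m) = x * (e - y ^+ n * a * d - c * y ^+ m * b - c * x * d).
  by rewrite !mulrBr -h eu ev exprD; ring.
by rewrite -[LHS](mulKr abu) E mulrCA.
Qed.

End Params.
End RegularParameters.

(** * Representations by monomials *)

Section Monomials.
Variables (D : idomainType) (x y : D).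
Hypothesis reg : regular_parameters x y.
Implicit Types (e : nat * nat) (s : seq (D * (nat * nat))).

Local Notation mon := (monomial x y).
Definition expD e e' : nat * nat := ((e.1 + e'.1)%N, (e.2 + e'.2)%N).

Lemma monomialD e e' : mon (expD e e') = mon e * mon e'.
Proof. by rewrite /monomial /= !exprD; ring. Qed.

Lemma x_neq0 : x != 0.
Proof.
apply/eqP => x0; apply: (@y_power_notin _ _ _ (regular_parametersC reg) 1%N).
by exists 0; rewrite expr1 x0 mulr0.
Qed.

Lemma y_neq0 : y != 0.
Proof.
apply/eqP => y0; apply: (@y_power_notin _ _ _ reg 1%N).
by exists 0; rewrite expr1 y0 mulr0.
Qed.

Lemma monomial_neq0 e : mon e != 0.
Proof. by rewrite mulf_neq0 // expf_neq0 // ?x_neq0 ?y_neq0. Qed.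

Lemma x_power_cancel p m d :
  mult_of (x ^+ p) (y ^+ m * d) -> mult_of (x ^+ p) d.
Proof.
elim: p d => [|p IH] d; first by exists d; rewrite expr0 mul1r.
move=> [c e]; have [|/(y_power_notin reg)//|[d' ed]] := @mult_of_x_prime _ _ _ reg (y ^+ m) d.
  by exists (x ^+ p * c); rewrite e exprS mulrA.
have [|d'' ed'] := IH d'; last by exists d''; rewrite ed ed' exprS mulrA.
exists c; apply: (mulfI x_neq0); rewrite mulrCA -ed e exprS; ring.
Qed.

(** Cancelling [x^p] is possible because [x] is prime and does not divide [y];
what remains says that [x] divides [y^q (1 - f y)], where the last factor is a
unit. *)
Lemma monomial_notin e c d :
  mon e <> x ^+ e.1.+1 * c + y ^+ e.2.+1 * d.
Proof.
case: e => p q; rewrite /monomial /= => E.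
have [|f ef] := @x_power_cancel p q.+1 d.
  exists (y ^+ q - x * c).
  have -> : y ^+ q.+1 * d = x ^+ p * y ^+ q - x ^+ p.+1 * c by rewrite E; ring.
  by rewrite exprS; ring.
have E' : x * c = y ^+ q * (1 - f * y).
  apply: (mulfI (expf_neq0 p x_neq0)).
  have -> : x ^+ p * (x * c) = x ^+ p * y ^+ q - y ^+ q.+1 * d.
    by rewrite E exprS; ring.
  by rewrite ef exprS; ring.
apply: (@y_power_notin _ _ _ reg q); exists (c / (1 - f * y)).
by rewrite mulrA E' mulrK // (unit1By reg).
Qed.

Lemma monomial_divides e e' :
  divides (mon e) (mon e') -> (e.1 <= e'.1)%N /\ (e.2 <= e'.2)%N.
Proof.
move=> [c E]; split; rewrite leqNgt; apply/negP => lt.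
  apply: (@monomial_notin e' (c * x ^+ (e.1 - e'.1.+1) * y ^+ e.2) 0).
  by rewrite E /monomial -{1}(subnKC lt) exprD; ring.
apply: (@monomial_notin e' 0 (c * y ^+ (e.2 - e'.2.+1) * x ^+ e.1)).
by rewrite E /monomial -{1}(subnKC lt) exprD; ring.
Qed.

Lemma monomial_inj : injective mon.
Proof.
move=> e e' E.
have [|l1 l2] := @monomial_divides e e'; first by exists 1; rewrite mul1r.
have [|l3 l4] := @monomial_divides e' e; first by exists 1; rewrite mul1r.
by case: e e' {E} l1 l2 l3 l4 => [a b] [c d] /= *; congr pair; lia.
Qed.

Definition unit_terms s := {in s, forall t, t.1 \is a GRing.unit}.
Definition eval s := \sum_(t <- s) t.1 * mon t.2.

(** The exponents form an antichain of the componentwise order. *)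
Definition staircase s := [/\ unit_terms s, uniq [seq t.2 | t <- s] &
  {in s &, forall t t', (t.2.1 <= t'.2.1)%N -> (t.2.2 <= t'.2.2)%N -> t.2 = t'.2}].

Lemma staircase_rep s : staircase s -> monomial_rep x y (eval s) s.
Proof.
move=> [su sq sa]; split=> //.
  by rewrite (map_comp mon snd) map_inj_uniq //; exact: monomial_inj.
move=> t t' ts ts' /eqP ne /monomial_divides [l1 l2].
by apply: ne; rewrite (sa _ _ ts ts').
Qed.

(** Here [p] is the largest power with [d] in [x^p D + B]; it exists by Krull's
theorem. *)
Lemma x_adic_form B d : is_ideal B -> ~ B d ->
  exists p q u c b, [/\ u \is a GRing.unit, B b,
    d = x ^+ p * (y ^+ q * u + x * c) + b &
    forall c b, B b -> d <> x ^+ p.+1 * c + b].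
Proof.
move=> BI Bd.
have [p [f [c [Bc E]]] nE] : exists2 p, (exists f c, B c /\ d = x ^+ p * f + c)
    & ~ (exists f c, B c /\ d = x ^+ p.+1 * f + c).
  apply: contrapT => H; apply: Bd; apply: (krull_intersection reg BI (unit1Bx reg)).
  elim=> [|p IH]; last by apply: contrapT => h; apply: H; exists p.
  by exists d, 0; split; [exact: BI.1|rewrite expr0 mul1r addr0].
have [|q [u [c' [uu E']]]] := @y_power_form _ _ _ reg f.
  by move=> [c' f']; apply: nE; exists c', c; rewrite E f' exprSr mulrA.
exists p, q, u, c', c; split=> //; first by rewrite E E'.
by move=> g b Bb E''; apply: nE; exists g, b.
Qed.

(** Multiplying by [x^(p+1)] moves the given staircase to the right of [(p, q)],
and its steps lie below [q]; the error term [x^(p+1) y^q f] is absorbed in the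
unit coefficient of [x^p y^q]. *)
Lemma staircase_cons p q u c s f : u \is a GRing.unit -> staircase s ->
  {in s, forall t, (t.2.2 < q)%N} -> c = eval s + y ^+ q * f ->
  let s' := (u + x * f, (p, q)) :: [seq (t.1, expD (p.+1, 0%N) t.2) | t <- s] in
  [/\ staircase s', {in s', forall t, (t.2.2 <= q)%N} &
      x ^+ p * (y ^+ q * u + x * c) = eval s'].
Proof.
move=> uu [su sq sa] slt Ec s'.
have tl t : t \in s' -> t = (u + x * f, (p, q)) \/
    exists2 t0, t0 \in s & t = (t0.1, expD (p.+1, 0%N) t0.2).
  by rewrite inE => /orP[/eqP|/mapP]; [left|right].
split.
- split.
  + move=> t /tl[->|[t0 t0s ->]] /=; last exact: su.
    have -> : u + x * f = u * (1 - (- (u^-1 * f)) * x).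
      by rewrite mulrBr mulNr mulrN opprK mulr1 !mulrA mulrV // mul1r mulrC.
    by rewrite unitrM uu (unit1Bx reg).
  + rewrite /s' /= -map_comp; apply/andP; split.
      apply/negP => /mapP[t ts] [_]; rewrite add0n => qt.
      by have := slt _ ts; rewrite qt ltnn.
    rewrite (map_comp (expD (p.+1, 0%N)) snd) map_inj_uniq //.
    by move=> [a b] [a' b'] [/addnI -> /addnI ->].
  + move=> t t' /tl[->|[t0 ts ->]] /tl[->|[t0' ts' ->]] //=; rewrite ?add0n.
    * by move=> _; have := slt _ ts'; rewrite ltnNge => /negP.
    * by rewrite addSn ltnNge leq_addr.
    * by rewrite leq_add2l => l1 l2; rewrite (sa _ _ ts ts').
- move=> t /tl[->|[t0 ts ->]] //=; rewrite add0n; exact/ltnW/slt.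
rewrite /eval big_cons big_map /= Ec /eval.
under [in RHS]eq_bigr do rewrite monomialD mulrCA.
by rewrite -mulr_sumr /monomial /= exprS expr0; ring.
Qed.

(** Induction on [n], modulo [y^n]: the first step of the staircase of [d] is at
a height [q < n], and the coefficient of [x^(p+1)] only matters modulo [y^q]. *)
Lemma staircase_mod n d : exists s f,
  [/\ staircase s, {in s, forall t, (t.2.2 < n)%N} & d = eval s + y ^+ n * f].
Proof.
have [m] := ubnP n; elim: m n d => // m IH n d /ltnSE nm.
have [[f ->]|nd] := pselect (mult_of (y ^+ n) d).
  by exists [::], f; rewrite /eval big_nil add0r; split.
have [p [q [u [c [b [uu [g ->] E nE]]]]]] := x_adic_form (mult_of_ideal _) nd.
have qn : (q < n)%N.
  rewrite ltnNge; apply/negP => nq.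
  apply: (nE c (y ^+ n * (g + x ^+ p * y ^+ (q - n) * u))); first by eexists.
  by rewrite E -{1}(subnKC nq) exprD exprS; ring.
have [s [f [ss slt Ec]]] := IH q c (leq_trans qn nm).
have [ss' slt' E'] := staircase_cons p uu ss slt Ec.
eexists; exists g; split; [exact: ss'| |by rewrite E E'].
by move=> t /slt' tq; apply: leq_ltn_trans qn.
Qed.

(** The first step of the staircase is found modulo the zero ideal; the remaining
ones are obtained modulo [y^q], as only finitely many heights are left. *)
Lemma monomial_rep_ex d : exists s, monomial_rep x y d s.
Proof.
suff [s ss ->] : exists2 s, staircase s & d = eval s.
  by exists s; apply: staircase_rep.
have [d0|nd] := pselect (mult_of 0 d).
  exists [::] => //; have [c ->] := d0; by rewrite /eval big_nil mul0r.
have [p [q [u [c [b [uu [f ->] E _]]]]]] := x_adic_form (mult_of_ideal _) nd.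
have [s [e [ss slt Ec]]] := staircase_mod q c.
have [ss' _ E'] := staircase_cons p uu ss slt Ec.
by eexists; [exact: ss'|rewrite E E' mul0r addr0].
Qed.

Lemma monomial_rep_uniq d s : monomial_rep x y d s -> uniq [seq t.2 | t <- s].
Proof. by move=> [_ _ + _]; rewrite (map_comp mon snd) map_inj_uniq //; exact: monomial_inj. Qed.

(** * Leading exponents and the monomial valuation *)

Section Valuation.
Variables (R : realType) (r : R).
Hypothesis r0 : 0 < r.

Definition weight e : R := e.1%:R + e.2%:R * r.

(** The second criterion makes the order total when [r] is rational, and it is
chosen so that a larger exponent has a larger first or second component. *)
Definition prec e e' :=
  (weight e < weight e') || ((weight e == weight e') && (e.1 < e'.1)%N).

Lemma weightD e e' : weight (expD e e') = weight e + weight e'.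
Proof. by rewrite /weight /= !natrD; ring. Qed.

Lemma prec_weight e e' : prec e e' -> weight e <= weight e'.
Proof. by case/orP=> [/ltW//|/andP[/eqP ->]]. Qed.

Lemma prec_trans e2 e1 e3 : prec e1 e2 -> prec e2 e3 -> prec e1 e3.
Proof.
case/orP=> [l|/andP[/eqP E l]] h.
  by rewrite /prec (lt_le_trans l (prec_weight h)).
move: h; rewrite /prec E => /orP[->//|/andP[-> l']].
by rewrite (ltn_trans l l') orbT.
Qed.

Lemma prec_total e e' : e != e' -> prec e e' || prec e' e.
Proof.
move=> ne; rewrite /prec; case: ltgtP => //= E; rewrite -neq_ltn.
apply: contra_neq ne => E1.
case: e e' E E1 => [a b] [c d]; rewrite /weight /= => + ac; rewrite ac.
by move=> /addrI /(mulIf (lt0r_neq0 r0)) /eqP; rewrite eqr_nat => /eqP ->.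
Qed.

Lemma precDl g e e' : prec e e' -> prec (expD g e) (expD g e').
Proof.
by rewrite /prec !weightD ltrD2l (inj_eq (addrI _)) /= ltn_add2l.
Qed.

Lemma expDC e e' : expD e e' = expD e' e.
Proof. by rewrite /expD addnC [in X in (_, X)]addnC. Qed.

Definition above e : set D :=
  [set h | exists2 s, h = eval s & {in s, forall t, prec e t.2}].

Lemma above_ideal e : is_ideal (above e).
Proof.
split; first by exists [::] => //; rewrite /eval big_nil.
move=> a u v [s -> sp] [s' -> sp'].
exists ([seq (a * t.1, t.2) | t <- s] ++ s').
  rewrite /eval big_cat big_map mulr_sumr; congr (_ + _).
  by apply: eq_bigr => t _; rewrite mulrA.
by move=> t; rewrite mem_cat => /orP[/mapP[t0 ts ->]|/sp'//]; exact: (sp t0).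
Qed.

Lemma above_monomial e e' : prec e e' -> above e (mon e').
Proof.
move=> p; exists [:: (1, e')]; first by rewrite /eval big_seq1 mul1r.
by move=> t; rewrite inE => /eqP ->.
Qed.

Lemma above_trans e e' : prec e e' -> above e' `<=` above e.
Proof.
move=> p h [s -> sp]; exists s => // t /sp; exact: prec_trans.
Qed.

Lemma aboveM g e h : above e h -> above (expD g e) (mon g * h).
Proof.
move=> [s -> sp]; rewrite /eval mulr_sumr.
apply: is_ideal_sum => [|t ts]; first exact: above_ideal.
rewrite mulrCA -monomialD; apply: is_idealM; first exact: above_ideal.
by apply: above_monomial; apply: precDl; apply: sp.
Qed.

Lemma above_mulr e e' h h' : above e h -> above e' h' -> above (expD e e') (h * h').
Proof.
move=> [s -> sp] hh'; rewrite /eval mulr_suml.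
apply: is_ideal_sum => [|t ts]; first exact: above_ideal.
rewrite -mulrA; apply: is_idealM; first exact: above_ideal.
apply: (@above_trans _ (expD t.2 e')); last exact: aboveM.
by rewrite [expD e _]expDC [expD t.2 _]expDC; apply: precDl; apply: sp.
Qed.

(** A larger exponent exceeds [e] in one of its components, so [above e] is
contained in the ideal of [monomial_notin]. *)
Lemma monomial_notin_above e : ~ above e (mon e).
Proof.
move=> [s E sp]; have := @monomial_notin e.
suff [c [d ->]] : exists c d, mon e = x ^+ e.1.+1 * c + y ^+ e.2.+1 * d.
  by move=> /(_ c d).
pose J := [set z | exists a b, mult_of (y ^+ e.2.+1) b /\ z = x ^+ e.1.+1 * a + b].
have [a [b [[d ->] ->]]] : J (mon e); last by exists a, d.
rewrite E; apply: is_ideal_sum => [|t ts].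
  exact/mulD_ideal/mult_of_ideal.
apply: is_idealM; first exact/mulD_ideal/mult_of_ideal.
have : (e.1 < t.2.1)%N \/ (e.2 < t.2.2)%N.
  case/orP: (sp _ ts) => [l|/andP[_ ?]]; last by left.
  apply/orP; apply: contraLR l; rewrite negb_or -!leqNgt -leNgt => /andP[l1 l2].
  by rewrite /weight lerD ?ler_nat // ler_wpM2r ?ler_nat // ltW.
case=> l; rewrite /monomial -(subnKC l) exprD.
  exists (x ^+ (t.2.1 - e.1.+1) * y ^+ t.2.2), 0; split; last by ring.
  exact: (mult_of_ideal _).1.
exists 0; eexists; split; last by rewrite mulr0 add0r.
by exists (x ^+ t.2.1 * y ^+ (t.2.2 - e.2.+1)); ring.
Qed.

Definition lead f e :=
  exists u h, [/\ u \is a GRing.unit, above e h & f = u * mon e + h].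

Lemma lead_notin f e : lead f e -> ~ above e f.
Proof.
move=> [u [h [uu ah ->]]] aj; apply: (@monomial_notin_above e).
rewrite -[mon e](mulKr uu); apply: is_idealM; first exact: above_ideal.
by rewrite -[u * _](addrK h); apply: is_idealB => //; exact: above_ideal.
Qed.

Lemma lead_above f e e' : lead f e -> prec e' e -> above e' f.
Proof.
move=> [u [h [uu ah ->]]] p; apply: is_idealD; first exact: above_ideal.
  by apply: is_idealM; [exact: above_ideal|exact: above_monomial].
exact: above_trans ah.
Qed.

Lemma lead_uniq f e e' : lead f e -> lead f e' -> e = e'.
Proof.
move=> le le'; apply: contrapT => /eqP /prec_total /orP[p|p].
  exact: (lead_notin le (lead_above le' p)).
exact: (lead_notin le' (lead_above le p)).
Qed.

Lemma lead_neq0 f e : lead f e -> f != 0.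
Proof.
by move=> /lead_notin nf; apply/eqP => f0; apply: nf; rewrite f0; exact: (above_ideal e).1.
Qed.

Lemma leadM f g e e' : lead f e -> lead g e' -> lead (f * g) (expD e e').
Proof.
move=> [u [h [uu ah ->]]] [u' [h' [uu' ah' ->]]].
exists (u * u'), (u * (mon e * h') + (u' * (mon e' * h) + h * h')).
have aI := above_ideal (expD e e').
split; [by rewrite unitrM uu| |by rewrite monomialD; ring].
apply: aI.2; first exact: aboveM.
apply: aI.2; last exact: above_mulr.
by rewrite expDC; apply: aboveM.
Qed.

(** The leading exponent of a sum of distinct monomials with unit coefficients is
the smallest one; in particular no cancellation occurs. *)
Lemma eval_lead s : unit_terms s -> uniq [seq t.2 | t <- s] -> s != [::] ->
  exists t0, [/\ t0 \in s, lead (eval s) t0.2 &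
                 {in s, forall t, weight t0.2 <= weight t.2}].
Proof.
move=> su sq s0.
have [t0 ts tmin] : exists2 t0, t0 \in s &
    {in s, forall t, t.2 != t0.2 -> prec t0.2 t.2}.
  elim: s {su sq} s0 => // t s IH _.
  have [->|/IH [t0 ts tmin]] := eqVneq s [::].
    by exists t; rewrite ?inE // => t'; rewrite inE => /eqP ->; rewrite eqxx.
  have [E|ne] := eqVneq t.2 t0.2.
    exists t0 => [|t']; first by rewrite inE ts orbT.
    rewrite inE => /orP[/eqP ->|/tmin//]; by rewrite E eqxx.
  have /orP[p|p] := prec_total ne.
    exists t => [|t']; first by rewrite inE eqxx.
    rewrite inE => /orP[/eqP ->|/tmin p' _]; first by rewrite eqxx.
    have [->//|/p'] := eqVneq t'.2 t0.2; exact: prec_trans.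
  exists t0 => [|t']; first by rewrite inE ts orbT.
  by rewrite inE => /orP[/eqP ->|/tmin].
exists t0; split=> //; last first.
  by move=> t /tmin; have [->//|_ /(_ isT) /prec_weight] := eqVneq t.2 t0.2.
exists t0.1, (eval (rem t0 s)); split; first exact: su; last first.
  by rewrite /eval (perm_big _ (perm_to_rem ts)) big_cons.
exists (rem t0 s) => // t tr; apply: tmin; first exact: mem_rem tr.
have := sq; rewrite (perm_uniq (perm_map _ (perm_to_rem ts))) /= => /andP[+ _].
by apply: contraNneq => <-; apply: map_f.
Qed.

Lemma bigmin_attained (T : eqType) (s : seq T) (F : T -> \bar R) i : i \in s ->
  {in s, forall j, F i <= F j}%E -> \big[Order.min/+oo%E]_(j <- s) F j = F i.
Proof.
move=> si Fi; apply/le_anti/andP; split; first exact: ge_bigmin_seq.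
by rewrite big_seq; apply: le_bigmin => //; exact: leey.
Qed.

Lemma monomial_val_ring_lead f : f != 0 -> exists2 e, lead f e &
  monomial_val_ring x y r f = (weight e)%:E.
Proof.
move=> f0; rewrite /monomial_val_ring (negPf f0).
have [s0 rep0] := monomial_rep_ex f.
have /= rep := @xgetI _ [::] [set s | monomial_rep x y f s] s0 rep0.
move: (xget _ _) rep => s rep; have sq := monomial_rep_uniq rep.
have [E su _ _] := rep.
have [|t0 [ts l tmin]] := eval_lead su sq.
  by apply: contra_neq f0 => s00; rewrite E s00 big_nil.
exists t0.2; first by rewrite E.
by rewrite (bigmin_attained (i := t0)) // => t /tmin; rewrite lee_fin.
Qed.

Definition wt f : R := fine (monomial_val_ring x y r f).

Lemma monomial_val_ring_wt f : f != 0 -> monomial_val_ring x y r f = (wt f)%:E.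
Proof. by rewrite /wt => /monomial_val_ring_lead [e _ ->]. Qed.

Lemma wt_lead f e : lead f e -> wt f = weight e.
Proof.
move=> l; have [e' l' E] := monomial_val_ring_lead (lead_neq0 l).
by rewrite /wt E (lead_uniq l l').
Qed.

Lemma lead_ex f : f != 0 -> exists e, lead f e.
Proof. by move=> /monomial_val_ring_lead [e l _]; exists e. Qed.

Lemma wtM f g : f != 0 -> g != 0 -> wt (f * g) = wt f + wt g.
Proof.
move=> /lead_ex [e l] /lead_ex [e' l'].
by rewrite (wt_lead l) (wt_lead l') (wt_lead (leadM l l')) weightD.
Qed.

Lemma wtB f g : f != 0 -> g != 0 -> f - g != 0 ->
  Num.min (wt f) (wt g) <= wt (f - g).
Proof.
move=> /lead_ex [e l] /lead_ex [e' l'] /lead_ex [e'' l''].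
rewrite (wt_lead l) (wt_lead l') (wt_lead l'') leNgt; apply/negP.
rewrite lt_min => /andP[h h']; apply: (lead_notin l'').
apply: is_idealB; first exact: above_ideal.
  by apply: lead_above l _; rewrite /prec h.
by apply: lead_above l' _; rewrite /prec h'.
Qed.

Lemma wt_eval_le s t : unit_terms s -> uniq [seq t.2 | t <- s] -> t \in s ->
  wt (eval s) <= weight t.2.
Proof.
move=> su sq ts; have [|t0 [_ l tmin]] := eval_lead su sq.
  by case: s ts {su sq}.
by rewrite (wt_lead l) tmin.
Qed.

Lemma eval_neq0 s : unit_terms s -> uniq [seq t.2 | t <- s] -> s != [::] ->
  eval s != 0.
Proof. by move=> su sq s0; have [t [_ /lead_neq0]] := eval_lead su sq s0. Qed.

Lemma wt_monomial e : wt (mon e) = weight e.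
Proof.
apply: wt_lead; exists 1, 0; split; rewrite ?unitr1 ?mul1r ?addr0 //.
exact: (above_ideal e).1.
Qed.

End Valuation.
End Monomials.

(** * Localizations of subrings of a field *)

Section Localization.
Variable K : fieldType.
Implicit Types A P V : set K.

Lemma subring_closedP A : subring_closed [in A] <->
  [/\ A 1, forall u v, A u -> A v -> A (u - v) & forall u v, A u -> A v -> A (u * v)].
Proof.
split=> -[A1 AB AM]; split.
- by move: A1; rewrite inE.
- by move=> u v; have := AB u v; rewrite !inE.
- by move=> u v; have := AM u v; rewrite !inE.
- by rewrite inE.
- by move=> u v; rewrite !inE; apply: AB.
- by move=> u v; rewrite !inE; apply: AM.
Qed.

Lemma subring_sum A (T : eqType) (s : seq T) (F : T -> K) : subring_closed [in A] ->
  (forall i, i \in s -> A (F i)) -> A (\sum_(i <- s) F i).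
Proof.
move=> /subring_closedP[A1 AB AM] AF.
have A0 : A 0 by rewrite -(subrr 1); apply: AB.
rewrite big_seq; elim/big_rec: _ => // i v si Av.
by rewrite -[v]opprK; apply: (AB _ _ (AF _ si)); rewrite -sub0r; apply: AB.
Qed.

Lemma frac_chain (a d b c : K) : b != 0 -> c != 0 ->
  a / b * (b / c) * (c / d) = a / d.
Proof. by move=> b0 c0; rewrite !mulrA !divfK. Qed.

Section Prime.
Variables A P : set K.
Hypotheses (AS : subring_closed [in A]) (PP : prime_ideal_of A P).

Let A1 : A 1. Proof. by have /subring_closedP[] := AS. Qed.
Let AB u v : A u -> A v -> A (u - v).
Proof. by have /subring_closedP[_ + _] := AS; apply. Qed.
Let AM u v : A u -> A v -> A (u * v).
Proof. by have /subring_closedP[_ _] := AS; apply. Qed.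

Lemma notin_prime_neq0 s : ~ P s -> s != 0.
Proof. by have [_ [P0 _] _ _] := PP; apply: contra_not_neq => ->. Qed.

Lemma notin_primeM s t : A s -> A t -> ~ P s -> ~ P t -> ~ P (s * t).
Proof. by have [_ _ _ Pp] := PP; move=> As At Ps Pt /(Pp _ _ As At)[]. Qed.

Lemma localization_sub : A `<=` localization A P.
Proof.
have [_ [_ P1] _ _] := PP.
by move=> z Az; exists z, 1; split; rewrite ?divr1.
Qed.

Lemma localization_subring : subring_closed [in localization A P].
Proof.
apply/subring_closedP; split; first exact: localization_sub.
- move=> u v [a [s [Aa As Ps ->]]] [b [t [Ab At Pt ->]]].
  exists (a * t - b * s), (s * t); split; [by apply: AB; apply: AM|exact: AM| |].
    exact: notin_primeM.
  have s0 := notin_prime_neq0 Ps; have t0 := notin_prime_neq0 Pt.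
  by field; rewrite s0 t0.
- move=> u v [a [s [Aa As Ps ->]]] [b [t [Ab At Pt ->]]].
  exists (a * b), (s * t); split; [exact: AM|exact: AM|exact: notin_primeM|].
  by rewrite invfM; ring.
Qed.

Lemma coprime_localization a b : A a -> A b -> a + b = 1 ->
  a != 0 -> b != 0 -> localization A P (b / a) \/ localization A P (a / b).
Proof.
move=> Aa Ab ab a0 b0; have [_ [_ P1] PD _] := PP.
have [Pa|Pa] := pselect (P a); last by left; exists b, a.
right; exists a, b; split=> // Pb; apply: P1; rewrite -ab -[a]mul1r; exact: PD.
Qed.

End Prime.
End Localization.

(** * The valuation on the fraction field *)

Section FractionField.
Variables (D : idomainType) (x y : D).
Hypothesis reg : regular_parameters x y.
Local Notation K := {fraction D}.
Local Notation "f %:F" := (@tofrac D f).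
Local Notation mon := (monomial x y).

Lemma fraction_ex (z : K) : exists f g : D, g != 0 /\ z = f%:F / g%:F.
Proof.
elim/quotW: z => q; exists q.1, q.2; split; first exact: denom_ratioP.
apply: (canRL (mulfK _)); first by rewrite tofrac_eq0 denom_ratioP.
rewrite /FracField.tofrac; unlock; rewrite -[LHS]FracField.pi_mul.
apply/eqmodP; rewrite /= FracField.equivfE /FracField.mulf.
by rewrite !numden_Ratio ?mulf_neq0 ?denom_ratioP ?oner_neq0 // !mulr1 mulrC.
Qed.

Lemma fraction_neq0 (z : K) : z != 0 ->
  exists f g : D, [/\ f != 0, g != 0 & z = f%:F / g%:F].
Proof.
have [f [g [g0 ->]]] := fraction_ex z => h; exists f, g; split=> //.
by apply: contra_neq h => ->; rewrite tofrac0 mul0r.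
Qed.

Lemma fraction_eq (f g f' g' : D) : g != 0 -> g' != 0 ->
  f%:F / g%:F = f'%:F / g'%:F -> f * g' = f' * g.
Proof.
move=> g0 g'0 /eqP; rewrite eqr_div ?tofrac_eq0 // -!tofracM tofrac_eq.
by move/eqP.
Qed.

Section OneValuation.
Variables (R : realType) (r : R).
Hypothesis r0 : 0 < r.
Local Notation wt := (wt x y r).
Local Notation V := (monomial_val_valuation_ring x y r).

(** Meaningful for nonzero [z] only: at zero the infinite value becomes 0. *)
Definition mval (z : K) : R := fine (monomial_val x y r z).

Lemma monomial_val_frac (f g : D) : g != 0 ->
  monomial_val x y r (f%:F / g%:F) =
  (monomial_val_ring x y r f - monomial_val_ring x y r g)%E.
Proof.
move=> g0; apply: xget_unique; first by exists f, g.
move=> w [f' [g' [g'0 /(fraction_eq g0 g'0) E ->]]].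
rewrite !(monomial_val_ring_wt reg r0 g0) !(monomial_val_ring_wt reg r0 g'0).
have [f0|f0] := eqVneq f 0.
  have /eqP : f' * g = 0 by rewrite -E f0 mul0r.
  rewrite mulf_eq0 (negPf g0) orbF => /eqP ->.
  by rewrite f0 /monomial_val_ring eqxx.
have f'0 : f' != 0.
  apply: contra_neq f0 => f'0; apply: (mulIf g'0); by rewrite E f'0 !mul0r.
rewrite !(monomial_val_ring_wt reg r0) // -!EFinB; congr EFin.
have := congr1 wt E; rewrite !(wtM reg r0) //; lra.
Qed.

Lemma monomial_val0 : monomial_val x y r 0 = +oo%E.
Proof.
have -> : 0 = 0%:F / 1%:F :> K by rewrite tofrac0 mul0r.
rewrite monomial_val_frac ?oner_neq0 //.
rewrite (monomial_val_ring_wt reg r0 (oner_neq0 D)).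
by rewrite /monomial_val_ring eqxx.
Qed.

Lemma val_frac (f g : D) : f != 0 -> g != 0 -> mval (f%:F / g%:F) = wt f - wt g.
Proof.
by move=> f0 g0; rewrite /mval monomial_val_frac // !(monomial_val_ring_wt reg r0).
Qed.

Lemma mem_valuation_ringP z : V z <-> (z != 0 -> 0 <= mval z).
Proof.
rewrite /V /=; have [->|z0] := eqVneq z 0.
  by rewrite monomial_val0; split=> // _; exact: leey.
have [f [g [f0 g0 ->]]] := fraction_neq0 z0.
rewrite val_frac // monomial_val_frac // !(monomial_val_ring_wt reg r0) //.
by rewrite -EFinB lee_fin; split=> // /(_ isT).
Qed.

Lemma valM u v : u != 0 -> v != 0 -> mval (u * v) = mval u + mval v.
Proof.
move=> /fraction_neq0[f [g [f0 g0 ->]]] /fraction_neq0[f' [g' [f'0 g'0 ->]]].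
have -> : f%:F / g%:F * (f'%:F / g'%:F) = (f * f')%:F / (g * g')%:F :> K.
  by rewrite !tofracM invfM; ring.
rewrite !val_frac ?mulf_neq0 // !(wtM reg r0) //; ring.
Qed.

Lemma val_tofrac f : f != 0 -> mval f%:F = wt f.
Proof.
move=> f0; have := @val_frac (f * f) f; rewrite mulf_neq0 // => /(_ isT f0).
rewrite tofracM mulfK ?tofrac_eq0 // => ->.
rewrite (wtM reg r0) //; ring.
Qed.

Lemma val1 : mval 1 = 0.
Proof. by have := @valM 1 1 (oner_neq0 _) (oner_neq0 _); rewrite mulr1; lra. Qed.

Lemma valV u : u != 0 -> mval u^-1 = - mval u.
Proof.
move=> u0; have := @valM u u^-1 u0; rewrite invr_neq0 // => /(_ isT).
rewrite mulfV // val1; lra.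
Qed.

Lemma valX u n : u != 0 -> mval (u ^+ n) = n%:R * mval u.
Proof.
move=> u0; elim: n => [|n IH]; first by rewrite expr0 val1 mul0r.
by rewrite exprS valM ?expf_neq0 // IH -natr1; ring.
Qed.

Lemma valB_ge0 u v : u != 0 -> v != 0 -> u - v != 0 ->
  0 <= mval u -> 0 <= mval v -> 0 <= mval (u - v).
Proof.
move=> /fraction_neq0[f [g [f0 g0 ->]]] /fraction_neq0[f' [g' [f'0 g'0 ->]]].
have -> : f%:F / g%:F - f'%:F / g'%:F = (f * g' - f' * g)%:F / (g * g')%:F :> K.
  by rewrite -mulNr addf_div ?tofrac_eq0 // mulNr tofracB !tofracM.
rewrite mulf_eq0 negb_or tofrac_eq0 => /andP[h _].
rewrite !val_frac ?mulf_neq0 // => h1 h2.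
have := wtB reg r0 _ _ h; rewrite !mulf_neq0 // => /(_ isT isT).
rewrite !(wtM reg r0) // minElt; case: ifP; lra.
Qed.

Lemma monomial_valuation_subring : subring_closed [in V].
Proof.
apply/subring_closedP; split; first by apply/mem_valuation_ringP; rewrite val1.
- move=> u v /mem_valuation_ringP Vu /mem_valuation_ringP Vv.
  apply/mem_valuation_ringP => uv.
  have [u0|u0] := eqVneq u 0.
    have v0 : v != 0 by move: uv; rewrite u0 sub0r oppr_eq0.
    rewrite u0 sub0r -mulN1r valM ?oppr_eq0 ?oner_neq0 //.
    have := @valM (-1) (-1); rewrite oppr_eq0 oner_neq0 mulrNN mulr1 val1.
    by move=> /(_ isT isT); have := Vv v0; lra.
  have [v0|v0] := eqVneq v 0; first by rewrite v0 subr0; exact: Vu.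
  by apply: valB_ge0 => //; [exact: Vu|exact: Vv].
- move=> u v /mem_valuation_ringP Vu /mem_valuation_ringP Vv.
  apply/mem_valuation_ringP; rewrite mulf_eq0 negb_or => /andP[u0 v0].
  by rewrite valM // addr_ge0 ?Vu ?Vv.
Qed.

Lemma monomial_valuation_ringP : valuation_ring V.
Proof.
split=> [|z _]; first exact: monomial_valuation_subring.
have [z0|z0] := eqVneq z 0; first by left; apply/mem_valuation_ringP; rewrite z0 eqxx.
have [h|h] := leP 0 (mval z); first by left; apply/mem_valuation_ringP.
by right; apply/mem_valuation_ringP => _; rewrite valV //; lra.
Qed.

Lemma wt_ge0 f : f != 0 -> 0 <= wt f.
Proof.
move=> /(lead_ex reg r0)[e /(wt_lead reg r0) ->].
by rewrite addr_ge0 // mulr_ge0 // ltW.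
Qed.

Lemma monomial_valuation_tofrac : range (@tofrac D) `<=` V.
Proof.
move=> _ [f _ <-]; apply/mem_valuation_ringP; rewrite tofrac_eq0 => f0.
by rewrite val_tofrac // wt_ge0.
Qed.

End OneValuation.

(** * The intersection of the monomial valuation rings *)

Section Intersection.
Variables (R : realType) (I : set R).
Hypothesis Ipos : forall r, I r -> 0 < r.

Definition monomial_intersection : set K :=
  \bigcap_(r in I) monomial_val_valuation_ring x y r.
Local Notation A := monomial_intersection.

Lemma mem_intersectionP z : A z <-> (z != 0 -> forall r, I r -> 0 <= mval r z).
Proof.
split=> [Az z0 r Ir|Az r Ir].
  by have /mem_valuation_ringP := Az r Ir; apply=> //; exact: Ipos.
by apply/mem_valuation_ringP => [|z0]; [exact: Ipos|exact: Az].
Qed.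

Lemma intersection_subring : subring_closed [in A].
Proof.
apply/subring_closedP; split=> [r /Ipos r0|u v Au Av r Ir|u v Au Av r Ir].
- by have /subring_closedP[] := monomial_valuation_subring r0.
- have /subring_closedP[_ VB _] := monomial_valuation_subring (Ipos Ir).
  by apply: VB; [exact: Au|exact: Av].
- have /subring_closedP[_ _ VM] := monomial_valuation_subring (Ipos Ir).
  by apply: VM; [exact: Au|exact: Av].
Qed.

Lemma intersection_tofrac f : A f%:F.
Proof. by move=> r /Ipos r0; apply: monomial_valuation_tofrac => //; exists f. Qed.

(** The inverse of an element of positive value is not in [V_r], hence not in
[V]. *)
Lemma valuation_overring_pos (V : set K) (r : R) z : 0 < r -> valuation_ring V ->
  range (@tofrac D) `<=` V -> V `<=` monomial_val_valuation_ring x y r ->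
  z != 0 -> 0 < mval r z -> V z.
Proof.
move=> r0 [_ Vv] DV VVr z0 zpos.
have [f [g [g0 E]]] := fraction_ex z.
have [|//|/VVr /(mem_valuation_ringP r0)] := Vv z.
  exists f%:F, g%:F; split; rewrite ?tofrac_eq0 //; by apply: DV; eexists.
by rewrite invr_neq0 // => /(_ isT); rewrite valV //; lra.
Qed.

(** The witness of almost integrality is [x], whose value is 1 for every [r]. *)
Lemma complete_integral_closure_interval_ring :
  complete_integral_closure (interval_ring x y I) = A.
Proof.
have x0 : x%:F != 0 :> K by rewrite tofrac_eq0 (x_neq0 reg).
apply/seteqP; split=> z.
  move=> [c [Tc c0 Tcz]]; apply/mem_intersectionP => z0 r Ir; have r0 := Ipos Ir.
  have TV w : interval_ring x y I w -> w != 0 -> 0 <= mval r w.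
    move=> Tw; apply/(mem_valuation_ringP r0); apply: Tw; split.
    - exact: monomial_valuation_ringP.
    - exact: monomial_valuation_tofrac.
    - by exists r.
  rewrite leNgt; apply/negP => zneg.
  have [n hn] : exists n : nat, mval r c < n.+1%:R * - mval r z.
    exists (Num.trunc (mval r c / - mval r z)).
    by rewrite -ltr_pdivrMr ?truncnS_gt // oppr_gt0.
  have := TV _ (Tcz n.+1 isT); rewrite mulf_neq0 ?expf_neq0 // => /(_ isT).
  rewrite (valM r0) ?expf_neq0 // (valX r0) //; lra.
move=> /mem_intersectionP Az.
exists x%:F; split=> // [V [_ DV _]|n _ V [Vv DV [r Ir VVr]]].
  by apply: DV; exists x.
have r0 := Ipos Ir.
have V0 : V 0 by apply: DV; exists 0; rewrite // tofrac0.
have [->|z0] := eqVneq z 0.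
  have [->|n0] := eqVneq n 0%N; first by rewrite expr0 mulr1; apply: DV; exists x.
  by rewrite expr0n (negPf n0) mulr0.
apply: (valuation_overring_pos r0 Vv DV VVr); first by rewrite mulf_neq0 ?expf_neq0.
rewrite (valM r0) ?expf_neq0 // (valX r0) // (val_tofrac r0) ?(x_neq0 reg) //.
have -> : wt x y r x = 1.
  have := wt_monomial reg r0 (1%N, 0%N).
  by rewrite {1}/monomial /= expr1 expr0 mulr1 => ->; rewrite /weight mul0r addr0.
by rewrite ltr_pwDl // mulr_ge0 // Az.
Qed.

(** [m / (m + m')] and [m' / (m + m')] are in [A] and have sum 1. *)
Lemma monomial_ratio_localization P e e' : prime_ideal_of A P ->
  localization A P ((mon e)%:F / (mon e')%:F) \/
  localization A P ((mon e')%:F / (mon e)%:F).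
Proof.
move=> PP; have [<-|ne] := eqVneq e e'.
  left; apply: (localization_sub intersection_subring PP); rewrite mulfV.
    by have /subring_closedP[] := intersection_subring.
  by rewrite tofrac_eq0 (monomial_neq0 reg).
set m := mon e; set m' := mon e'.
have m0 : m != 0 := monomial_neq0 reg e.
have m'0 : m' != 0 := monomial_neq0 reg e'.
(* Distinctness suffices here, even if one monomial divides the other. *)
pose s := [:: (1 : D, e); (1 : D, e')].
have su : unit_terms s.
  by move=> t; rewrite !inE => /orP[] /eqP ->; exact: unitr1.
have sq : uniq [seq t.2 | t <- s] by rewrite /= inE ne.
have Es : eval x y s = m + m' by rewrite /eval !big_cons big_nil /= !mul1r addr0.
have q0 : m + m' != 0 by rewrite -Es; exact: (eval_neq0 reg (ltr01 : (0 : R) < 1)).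
have q0' : (m + m')%:F != 0 by rewrite tofrac_eq0.
have A1 t : t \in s -> A ((mon t.2)%:F / (m + m')%:F).
  move=> ts; apply/mem_intersectionP => _ r Ir; have r0 := Ipos Ir.
  rewrite (val_frac r0) ?(monomial_neq0 reg) // subr_ge0 (wt_monomial reg r0) -Es.
  exact: (wt_eval_le reg r0).
have Am : A (m%:F / (m + m')%:F) by apply: (A1 (1, e)); rewrite inE eqxx.
have Am' : A (m'%:F / (m + m')%:F) by apply: (A1 (1, e')); rewrite !inE eqxx orbT.
have := coprime_localization intersection_subring PP Am Am'.
rewrite -mulrDl -tofracD mulfV // !mulf_neq0 ?invr_eq0 ?tofrac_eq0 //.
move=> /(_ erefl isT isT).
rewrite !invf_div !mulrA !divfK //; tauto.
Qed.

(** The monomial is the one that divides, in [A_P], all the monomials of a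
representation of [f]; the representation does not depend on [r]. *)
Lemma monomial_divisor P f : prime_ideal_of A P -> f != 0 ->
  exists e, localization A P (f%:F / (mon e)%:F) /\ A ((mon e)%:F / f%:F).
Proof.
move=> PP f0; have [s rep] := monomial_rep_ex reg f.
have sq := monomial_rep_uniq reg rep; have [E su _ _] := rep.
have s0 : s != [::] by apply: contra_neq f0 => s0; rewrite E s0 big_nil.
have LS := localization_subring intersection_subring PP.
have [_ _ LM] := (subring_closedP _).1 LS.
have [t0 ts tdiv] : exists2 t0, t0 \in s &
    forall t, t \in s -> localization A P ((mon t.2)%:F / (mon t0.2)%:F).
  have refl t : localization A P ((mon t)%:F / (mon t)%:F).
    by have [] := monomial_ratio_localization t t PP.
  elim: s {rep sq E su} s0 => // t s IH _.
  have [->|/IH [t0 ts tdiv]] := eqVneq s [::].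
    by exists t => [|t']; rewrite inE // => /eqP ->.
  have [h|h] := monomial_ratio_localization t.2 t0.2 PP.
    exists t0 => [|t']; first by rewrite inE ts orbT.
    by rewrite inE => /orP[/eqP ->|/tdiv].
  exists t => [|t']; first by rewrite inE eqxx.
  rewrite inE => /orP[/eqP -> //|/tdiv h'].
  have := LM _ _ h' h; rewrite mulrA divfK // tofrac_eq0; exact: monomial_neq0.
exists t0.2; split.
  rewrite E rmorph_sum mulr_suml; apply: (subring_sum LS) => t tin /=.
  rewrite tofracM -mulrA; apply: LM; last exact: tdiv.
  exact/(localization_sub intersection_subring PP)/intersection_tofrac.
apply/mem_intersectionP => _ r Ir; have r0 := Ipos Ir.
rewrite (val_frac r0) ?(monomial_neq0 reg) // subr_ge0 (wt_monomial reg r0).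
by rewrite {1}E; exact: (wt_eval_le reg r0).
Qed.

Lemma monomial_intersection_prufer : prufer_domain A.
Proof.
split=> [|P PP]; first exact: intersection_subring.
have LS := localization_subring intersection_subring PP.
have [_ _ LM] := (subring_closedP _).1 LS.
have Lsub := localization_sub intersection_subring PP.
split=> // z _; have [->|] := eqVneq z 0.
  by left; rewrite -tofrac0; exact/Lsub/intersection_tofrac.
move=> /fraction_neq0[f [g [f0 g0 ->]]].
have [e [fe /Lsub ef]] := monomial_divisor PP f0.
have [e' [ge /Lsub eg]] := monomial_divisor PP g0.
have mF t : (mon t)%:F != 0 :> K by rewrite tofrac_eq0 (monomial_neq0 reg).
rewrite invf_div; case: (monomial_ratio_localization e e' PP) => h; [left|right].
  by rewrite -(frac_chain f%:F g%:F (mF e) (mF e')); exact: LM (LM _ _ fe h) eg.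
by rewrite -(frac_chain g%:F f%:F (mF e') (mF e)); exact: LM (LM _ _ ge h) ef.
Qed.

End Intersection.
End FractionField.

Theorem mainTheorem4 (R : realType) (D : idomainType) (x y : D)
    (hD : regular_local_with [:: x; y]) (a b : R) (ha : 0 < a) (hab : a < b) :
  prufer_domain (complete_integral_closure (interval_ring x y `[a, b])).
Proof.
have reg := regular_local_parameters hD.
have Ipos (r : R) : [set` `[a, b]] r -> 0 < r.
  by rewrite /= in_itv /= => /andP[/(lt_le_trans ha)].
rewrite (complete_integral_closure_interval_ring reg Ipos).
exact: monomial_intersection_prufer.
Qed.
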